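(* Let $\varphi$ and $\psi$ be endomorphisms of a subshift $(X,\sigma)$. (1) If $\varphi^i(X)$ and $\psi^i(X)$ are infinite for all $i\ge0$ (hence in particular, if $X$ is infinite and $\varphi$ and $\psi$ are onto), then $-p_L(\varphi\psi)=-p_L(\psi\varphi)$ and $p_R(\varphi\psi)=p_R(\psi\varphi)$. (2) If $\varphi$ and $\psi$ are right-closing, then $-q_R(\varphi\psi)=-q_R(\psi\varphi)$; and if $\varphi$ and $\psi$ are left-closing, then $q_L(\varphi\psi)=q_L(\psi\varphi)$.
   Context: **Subshifts.** An alphabet is a finite set with at least two elements. For an alphabet $A$, $A^{\mathbb Z}$ carries the product topology; the shift maps $(a_j)_j$ to $(a_{j+1})_j$. A subshift $(X,\sigma)$ over $A$ is a closed $X\subset A^{\mathbb Z}$ with $\sigma(X)=X$, $\sigma$ being the restricted shift; $L_k(X)$ is the set of words of length $k$ occurring in points of $X$. An endomorphism of $(X,\sigma)$ is a continuous map $\varphi:X\to X$ commuting with $\sigma$ (not assumed onto). Points $(a_j),(b_j)\in X$ are left (resp. right) $\sigma$-asymptotic if there is $J\in\mathbb Z$ with $a_j=b_j$ for all $j\le J$ (resp. $j\ge J$). $\varphi$ is right-closing (resp. left-closing) if it never maps two distinct left (resp. right) $\sigma$-asymptotic points to the same point. **Type.** A local rule of neighborhood-size $N\ge 0$ on $X$ is a map $f:L_{N+1}(X)\to L_1(X)$ with $(f(a_j\dots a_{j+N}))_{j\in\mathbb Z}\in X$ for all $(a_j)\in X$. For $m,n\ge0$, $m+n=N$, $\varphi$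 is of $(m,n)$-type given by $f$ if $\varphi((a_j)_j)=(f(a_{j-m}\dots a_{j+n}))_j$. Every endomorphism arises this way. **Degrees.** Let $f$ be a local rule of neighborhood-size $N$. It is $I$ left-redundant ($I\ge0$) if for all $(a_j),(b_j)\in X$, $a_j=b_j$ for all $j\ge0$ implies $f(a_{-I}\dots a_{-I+N})=f(b_{-I}\dots b_{-I+N})$; $I$ right-redundant if $a_j=b_j$ for all $j\le0$ implies $f(a_{I-N}\dots a_I)=f(b_{I-N}\dots b_I)$. It is strictly $I$ left-redundant if $I$ left-redundant but not $I+1$ left-redundant, strictly $\infty$ left-redundant if $I$ left-redundant for all $I\ge0$; similarly for right. It is $k$ right-mergible ($k\ge0$) if $a_j=b_j$ for $j\le 0$ and $f(a_{j-N}\dots a_j)=f(b_{j-N}\dots b_j)$ for $1\le j\le k+1$ imply $a_1=b_1$; $k$ left-mergible if $a_j=b_j$ for $j\ge0$ and $f(a_{-j}\dots a_{-j+N})=f(b_{-j}\dots b_{-j+N})$ for $1\le j\le k+1$ imply $a_{-1}=b_{-1}$. It is strictly $k$ right-mergible if $k\ge 0$ is the least integer for which it is $k$ right-mergible, strictly $\infty$ right-mergible if there is none; similarly for left. If $\varphi$ is of $(m,n)$-type given by $f$ which is strictly $I$ left-redundant, strictly $J$ right-redundant, strictly $k$ right-mergible and strictly $l$ left-mergible, then $P_L(\varphi)=I-m$, $P_R(\varphi)=J-n$, and, if $X$ is infinite, $Q_R(\varphi)=n-k$, $Q_L(\varphi)=m-l$; if $X$ is finite, $Q_R(\varphi)=Q_L(\varphi)=\infty$.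 These are independent of the choice of $f$, $m$, $n$. **Limits.** $p_L(\varphi)=\lim_{s\to\infty}P_L(\varphi^s)/s$, $p_R(\varphi)=\lim_{s\to\infty} P_R(\varphi^s)/s$, $q_R(\varphi)=\lim_{s\to\infty} Q_R(\varphi^s)/s$, $q_L(\varphi)=\lim_{s\to\infty} Q_L(\varphi^s)/s$; these limits exist in $\mathbb R\cup\{\pm\infty\}$. *)

(* Defs.v *)
From mathcomp Require Import all_boot all_order all_algebra.
From mathcomp Require Import all_classical all_reals all_analysis.

Set Implicit Arguments.
Unset Strict Implicit.
Unset Printing Implicit Defensive.

Import Order.TTheory GRing.Theory Num.Theory.

Local Open Scope classical_set_scope.
Local Open Scope ring_scope.

Definition full_shift (A : finType) : topologicalType :=
  prod_topology (fun _ : int => discrete_topology A).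

Section Subshifts.
Variable A : finType.
Implicit Types (a b : full_shift A) (X : set (full_shift A)).

Definition shift_map a : full_shift A := fun j => a (j + 1).

Definition subshift X : Prop := closed X /\ shift_map @` X = X.

(* The word a_j a_{j+1} ... a_{j+k-1}. *)
Definition word (k : nat) a (j : int) : k.-tuple A :=
  [tuple (a (j + i%:Z) : A) | i < k].

Definition language X (k : nat) : set (k.-tuple A) :=
  [set w | exists a, X a /\ exists j, w = word k a j].

(* A self-map of X is represented by a map on the full shift that sends X into
   itself; every notion below only depends on its values on X. *)
Definition endomorphism X (phi : full_shift A -> full_shift A) : Prop :=
  [/\ {homo phi : a / X a},
      {within X, continuous phi} &
      forall a, X a -> phi (shift_map a) = shift_map (phi a)].

Definition left_asymptotic a b : Prop :=
  exists J : int, forall j : int, j <= J -> a j = b j.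

Definition right_asymptotic a b : Prop :=
  exists J : int, forall j : int, J <= j -> a j = b j.

Definition right_closing X (phi : full_shift A -> full_shift A) : Prop :=
  forall a b, X a -> X b -> left_asymptotic a b -> phi a = phi b -> a = b.

Definition left_closing X (phi : full_shift A -> full_shift A) : Prop :=
  forall a b, X a -> X b -> right_asymptotic a b -> phi a = phi b -> a = b.

(* A local rule L_{N+1}(X) -> L_1(X) is represented by a function on all words
   of length N+1, of which only the values on L_{N+1}(X) are ever used. *)
Definition local_rule X (N : nat) (f : N.+1.-tuple A -> A) : Prop :=
  (forall w, language X w -> language X [tuple f w]) /\
  (forall a, X a -> X (fun j => f (word N.+1 a j))).

Definition has_type X (phi : full_shift A -> full_shift A) (m n : nat)
    (f : (m + n).+1.-tuple A -> A) : Prop :=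
  local_rule X f /\
  forall a, X a -> phi a = (fun j => f (word (m + n).+1 a (j - m%:Z))).

Section Degrees.
Variables (X : set (full_shift A)) (N : nat) (f : N.+1.-tuple A -> A).

Definition left_redundant (I : nat) : Prop :=
  forall a b, X a -> X b -> (forall j : int, 0 <= j -> a j = b j) ->
    f (word N.+1 a (- I%:Z)) = f (word N.+1 b (- I%:Z)).

Definition right_redundant (I : nat) : Prop :=
  forall a b, X a -> X b -> (forall j : int, j <= 0 -> a j = b j) ->
    f (word N.+1 a (I%:Z - N%:Z)) = f (word N.+1 b (I%:Z - N%:Z)).

Definition right_mergible (k : nat) : Prop :=
  forall a b, X a -> X b -> (forall j : int, j <= 0 -> a j = b j) ->
    (forall j : int, 1 <= j <= k%:Z + 1 ->
       f (word N.+1 a (j - N%:Z)) = f (word N.+1 b (j - N%:Z))) ->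
    a 1 = b 1.

Definition left_mergible (k : nat) : Prop :=
  forall a b, X a -> X b -> (forall j : int, 0 <= j -> a j = b j) ->
    (forall j : int, 1 <= j <= k%:Z + 1 ->
       f (word N.+1 a (- j)) = f (word N.+1 b (- j))) ->
    a (-1) = b (-1).

End Degrees.

End Subshifts.

Section StrictDegrees.
Variable R : realType.

Definition strictly_redundant (red : nat -> Prop) (I : \bar R) : Prop :=
  (exists i : nat, [/\ I = i%:R%:E, red i & ~ red i.+1]) \/
  (I = +oo%E /\ forall i, red i).

Definition strictly_mergible (mer : nat -> Prop) (k : \bar R) : Prop :=
  (exists i : nat,
     [/\ k = i%:R%:E, mer i & forall i', mer i' -> (i <= i')%N]) \/
  (k = +oo%E /\ forall i, ~ mer i).

End StrictDegrees.

(* Each set below has exactly one element when X is a subshift, phi is an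
   endomorphism of X and, for Q_R and Q_L, X is infinite; [get] returns it. *)
Section PQ.
Variables (R : realType) (A : finType) (X : set (full_shift A)).
Variable phi : full_shift A -> full_shift A.

Definition P_L : \bar R :=
  get [set v | exists m n (f : (m + n).+1.-tuple A -> A) (I : \bar R),
    [/\ has_type X phi f, strictly_redundant (left_redundant X f) I
      & v = (I - m%:R%:E)%E]].

Definition P_R : \bar R :=
  get [set v | exists m n (f : (m + n).+1.-tuple A -> A) (J : \bar R),
    [/\ has_type X phi f, strictly_redundant (right_redundant X f) J
      & v = (J - n%:R%:E)%E]].

Definition Q_R : \bar R :=
  if `[< finite_set X >] then +oo%E else
  get [set v | exists m n (f : (m + n).+1.-tuple A -> A) (k : \bar R),
    [/\ has_type X phi f, strictly_mergible (right_mergible X f) k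
      & v = (n%:R%:E - k)%E]].

Definition Q_L : \bar R :=
  if `[< finite_set X >] then +oo%E else
  get [set v | exists m n (f : (m + n).+1.-tuple A -> A) (l : \bar R),
    [/\ has_type X phi f, strictly_mergible (left_mergible X f) l
      & v = (m%:R%:E - l)%E]].

End PQ.

Section Limits.
Variables (R : realType) (A : finType) (X : set (full_shift A)).
Variable phi : full_shift A -> full_shift A.

(* The sequences are indexed from s = 0; that term does not affect the limit. *)
Definition p_L : \bar R := limn (fun s => P_L R X (iter s phi) * s%:R^-1%:E)%E.
Definition p_R : \bar R := limn (fun s => P_R R X (iter s phi) * s%:R^-1%:E)%E.
Definition q_R : \bar R := limn (fun s => Q_R R X (iter s phi) * s%:R^-1%:E)%E.
Definition q_L : \bar R := limn (fun s => Q_L R X (iter s phi) * s%:R^-1%:E)%E.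

End Limits.

(* Main.v *)
Require Import Defs.
From mathcomp Require Import all_boot all_order all_algebra.
From mathcomp Require Import all_classical all_reals all_analysis.
From mathcomp Require Import zify.

(** An endomorphism phi of X has, on each side, an integer amount by which it
is certain to transport information. If a and b agree on [0, +oo), then phi a
and phi b agree on [-i, +oo) for some i, and P_L phi is the supremum of these i
(predicate [reach], side 1); P_R is its mirror image (side -1). Dually, if
a and b agree on (-oo, 0] and phi a and phi b agree on (-oo, 1 - i], it may
follow that a_1 = b_1, and Q_R phi is the supremum of the i for which it does
(predicate [merges], side -1, with Q_L its mirror image). Described this way,
the four degrees no longer mention a local rule or its type: this is the
content of [P_L_height], [P_R_height], [Q_R_height] and [Q_L_height].

Both predicates are superadditive: integers i for phi and j for psi give i + j
for the composite ([reach_comp], [merges_comp]). Now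

  (phi psi)^(s+1) = phi (psi phi)^s psi,

so, if i and j are fixed integers admitted by phi and psi, the degree of
(phi psi)^(s+1) is at least that of (psi phi)^s plus i + j, and symmetrically.
The two sequences of degrees thus interleave up to a constant, and after
division by s they have the same limits ([lim_rate_interleaved]); the squeeze
shows that one converges if and only if the other does, with values in the
extended reals, so that the existence of the limits does not enter.

What remains is to find i and j. For [reach] they come from the finite window
of a sliding block code ([sliding_block_reach]). For [merges] they come from
the closing hypothesis, by compactness ([closing_merges]).

The identification of Q_R with a supremum uses that X is infinite: in
an infinite subshift a left half of a point does not always determine the next
letter ([infinite_not_determined]), which bounds the integers admitted for
Q_R by n, and those for Q_L by m, whenever phi is of (m, n)-type; without this
bound the value n - k could depend on the type. If
X is finite, all the degrees Q_R and Q_L are +oo and there is nothing to prove.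
*)

Set Implicit Arguments.
Unset Strict Implicit.
Unset Printing Implicit Defensive.

Import Order.TTheory GRing.Theory Num.Theory.
Import numFieldNormedType.Exports.
Local Open Scope classical_set_scope.
Local Open Scope ring_scope.

(** * Cylinders and compactness of the full shift *)

Definition agree_near {A : Type} (W : nat) (a b : int -> A) : Prop :=
  forall j : int, - W%:Z <= j <= W%:Z -> a j = b j.

Section Cylinders.
Variable A : finType.

Lemma nbhs_cylinder (a : full_shift A) (W : nat) :
  nbhs a [set b : full_shift A | agree_near W a b].
Proof.
have coord (j : int) : \forall b \near a, b j = a j.
  exact: (@proj_continuous int (fun=> discrete_topology A) j a
            [set a j] (discrete_set1 (a j))).
(* the 2 W + 1 positions of the window are i - W for i : 'I_(W + W).+1 *)
have := @filter_forall _ 'I_(W + W).+1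
  (fun i b => b (i%:Z - W%:Z) = a (i%:Z - W%:Z)) (nbhs a)
  (nbhs_filter a) (fun i => coord _).
apply: filterS => b ab j Wj.
have lt_i : (absz (j + W%:Z)%R < (W + W).+1)%N by lia.
have := ab (Ordinal lt_i) => /=.
by rewrite (_ : (absz (j + W%:Z))%:Z - W%:Z = j); [move=> -> | lia].
Qed.

(** The sets containing a cylinder around a form a filter which converges to a
coordinatewise, hence in the product topology; so it refines the neighbourhood
filter of a. *)
Lemma nbhs_cylinderP (a : full_shift A) (U : set (full_shift A)) :
  nbhs a U -> exists W : nat, [set b | agree_near W a b] `<=` U.
Proof.
pose F : set_system (full_shift A) :=
  [set V | exists W : nat, [set b | agree_near W a b] `<=` V].
have FF : Filter F.
  split.
  - by exists 0%N.
  - move=> P Q [W WP] [W' WQ]; exists (W + W')%N => b ab.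
    by split; [apply: WP | apply: WQ] => j Wj; apply: ab; lia.
  - by move=> P Q PQ [W WP]; exists W => b /WP /PQ.
suff : F --> (a : full_shift A) by move=> /[apply].
apply/cvg_sup => j U' [V] [[T] oT <-] Taj VU'.
exists `|j|%N => b ab; apply: VU' => /=.
by rewrite -(ab j) //; lia.
Qed.

Lemma closed_cylinder (X : set (full_shift A)) (a : full_shift A) :
  closed X -> (forall W, exists2 b, X b & agree_near W a b) -> X a.
Proof.
move=> clX Xa; apply: clX => U /nbhs_cylinderP[W WU].
by have [b Xb ab] := Xa W; exists b; split=> //; apply: WU.
Qed.

(** Compactness in combinatorial form: a cluster point given by Tychonoff's
theorem, read through cylinders. *)
Lemma seq_cluster (u : nat -> full_shift A) :
  exists a, forall W K : nat, exists2 k, (K <= k)%N & agree_near W a (u k).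
Proof.
have cpt : compact [set: full_shift A].
  rewrite (_ : [set: _] = [set f : full_shift A |
      forall j : int, [set: discrete_topology A] (f j)]); last first.
    by apply/seteqP; split.
  apply: (@tychonoff int (fun=> discrete_topology A) (fun=> setT)) => j.
  by apply: finite_compact; exact: (@finite_finset A).
have Fu : ProperFilter (u @ \oo) by exact: fmap_proper_filter.
have [] := cpt (u @ \oo) Fu filterT.
move=> a [_ cla]; exists a => W K.
have [|_ [[k /= Kk <-] auk]] := cla [set u k | k in [set k | (K <= k)%N]]
    [set b | agree_near W a b] _ (nbhs_cylinder a W).
  by exists K => // k Kk; exists k.
by exists k.
Qed.

End Cylinders.

(** The same for pairs of points, which is what every argument by contradiction
below produces: a pair is one sequence over the alphabet of pairs of letters. *)
Lemma pair_cluster (A : finType) (X : set (full_shift A))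
    (u v : nat -> full_shift A) :
  closed X -> (forall k, X (u k)) -> (forall k, X (v k)) ->
  exists a b, [/\ X a, X b & forall W K : nat, exists k,
    [/\ (K <= k)%N, agree_near W a (u k) & agree_near W b (v k)]].
Proof.
move=> clX Xu Xv.
have [c cl_c] := @seq_cluster (A * A)%type
  (fun k j => ((u k j : A), (v k j : A))).
have cl W K : exists k, [/\ (K <= k)%N,
    agree_near W (fun j => (c j).1) (u k)
  & agree_near W (fun j => (c j).2) (v k)].
  have [k Kk ck] := cl_c W K; exists k; split=> // j Wj; by rewrite (ck j Wj).
exists (fun j => (c j).1), (fun j => (c j).2); split=> //.
- apply: closed_cylinder => // W; have [k [_ ak _]] := cl W 0%N.
  by exists (u k).
- apply: closed_cylinder => // W; have [k [_ _ bk]] := cl W 0%N.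
  by exists (v k).
Qed.

(** * Translations and half-lines *)

Definition translate {A : Type} (z : int) (a : int -> A) : int -> A :=
  fun j => a (j + z).

(** Left and right are treated together: the sign d selects a side, and the
half-line consists of the positions d * j for j >= t. *)
Definition agree_from {A : Type} (d t : int) (a b : int -> A) : Prop :=
  forall j : int, t <= j -> a (d * j) = b (d * j).

Lemma translate0 (A : Type) (a : int -> A) : translate 0 a = a.
Proof. by apply/funext => j; rewrite /translate addr0. Qed.

Lemma agree_from_le (A : Type) (d s t : int) (a b : int -> A) :
  s <= t -> agree_from d s a b -> agree_from d t a b.
Proof. by move=> st ab j tj; apply: ab; lia. Qed.

Lemma agree_from_translate (A : Type) (d s t : int) (a b : int -> A) :
  agree_from d s (translate (d * t) a) (translate (d * t) b) <->
  agree_from d (s + t) a b.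
Proof.
rewrite /translate; split=> ab j tj.
  have := ab (j - t); rewrite -mulrDr subrK; apply; lia.
by rewrite -mulrDr; apply: ab; lia.
Qed.

Lemma agree_from1 (A : Type) (a b : int -> A) (t : int) :
  agree_from 1 t a b <-> forall j : int, t <= j -> a j = b j.
Proof.
by split=> ab j tj; have := ab j tj; rewrite mul1r.
Qed.

Lemma agree_fromN1 (A : Type) (a b : int -> A) (t : int) :
  agree_from (- 1) t a b <-> forall j : int, j <= - t -> a j = b j.
Proof.
split=> ab j tj.
  by have := ab (- j); rewrite mulN1r opprK; apply; lia.
by rewrite mulN1r; apply: ab; lia.
Qed.

(** * Sliding block codes *)

Section SlidingBlocks.
Variables (A : finType) (X : set (full_shift A)).
Hypothesis hX : subshift X.

Lemma subshift_translate z a : X a -> X (translate z a).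
Proof.
have [_ sX] := hX => Xa.
have pos n : X (translate n%:Z a).
  elim: n => [|n Xn]; first by rewrite translate0.
  rewrite -sX; exists (translate n%:Z a) => //.
  by apply/funext => j; rewrite /shift_map /translate; congr a; lia.
have neg n : X (translate (- n%:Z) a).
  elim: n => [|n Xn]; first by rewrite oppr0 translate0.
  have [b Xb b_eq] : (shift_map (A := A) @` X) (translate (- n%:Z) a).
    by rewrite sX.
  suff -> : translate (- n.+1%:Z) a = b by [].
  apply/funext => j; have := congr1 (@^~ (j - 1)) b_eq.
  by rewrite /shift_map /translate subrK => ->; congr a; lia.
case: (lerP 0 z) => z0.
  by rewrite (_ : z = `|z|%N%:Z); [exact: pos | lia].
by rewrite (_ : z = - `|z|%N%:Z); [exact: neg | lia].
Qed.

(** The combinatorial content of continuity. Unlike continuity relative to X, it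
passes to composites by inspection. *)
Definition sliding_block (phi : full_shift A -> full_shift A) : Prop :=
  [/\ {homo phi : a / X a},
      exists W : nat, forall a b, X a -> X b -> agree_near W a b ->
        phi a 0 = phi b 0
    & forall z a, X a -> phi (translate z a) = translate z (phi a)].

(** The Curtis-Hedlund-Lyndon theorem. If no window determined the letter of the
image at 0, there would be pairs of points agreeing on larger and larger
windows with images different at 0; a cluster point of such pairs is a pair of
equal points, where continuity fails. *)
Lemma endomorphism_sliding_block phi : endomorphism X phi -> sliding_block phi.
Proof.
move=> [homX cont comm]; split=> //.
- apply/not_existsP => nloc.
  have /choice[uv uvP] W : exists ab : full_shift A * full_shift A,
      [/\ X ab.1, X ab.2, agree_near W ab.1 ab.2 & phi ab.1 0 <> phi ab.2 0].
    have /existsNP[a /existsNP[b]] := nloc W.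
    by move=> /not_implyP[Xa /not_implyP[Xb /not_implyP[ab nab]]]; exists (a, b).
  have [clX _] := hX.
  have [a [b [Xa Xb cl]]] := @pair_cluster _ X (fun k => (uv k).1)
    (fun k => (uv k).2) clX (fun k => let: And4 p _ _ _ := uvP k in p)
    (fun k => let: And4 _ p _ _ := uvP k in p).
  have eab : a = b.
    apply/funext => j; have [k [Kk ak bk]] := cl `|j|%N `|j|%N.
    rewrite ak; last by lia.
    rewrite bk; last by lia.
    by have [_ _ uvk _] := uvP k; apply: uvk; lia.
  move: cont => /subspace_continuousP /(_ a Xa) /(_ _ (nbhs_cylinder (phi a) 0)).
  move=> /nbhs_cylinderP[W WP].
  have [k [_ ak bk]] := cl W 0%N; have [Xu Xv _] := uvP k; apply.
  rewrite -eab in bk.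
  exact: etrans (esym (WP _ ak Xu 0 isT)) (WP _ bk Xv 0 isT).
- have pos n a : X a -> phi (translate n%:Z a) = translate n%:Z (phi a).
    move=> Xa; elim: n => [|n IH]; first by rewrite !translate0.
    have -> : translate n.+1%:Z a = shift_map (translate n%:Z a).
      by apply/funext => j; rewrite /shift_map /translate; congr a; lia.
    rewrite comm; last exact: subshift_translate.
    rewrite IH.
    by apply/funext => j; rewrite /shift_map /translate; congr (phi a); lia.
  move=> z a Xa; case: (lerP 0 z) => z0.
    by rewrite (_ : z = `|z|%N%:Z); [exact: pos | lia].
  have := pos `|z|%N (translate z a) (subshift_translate z Xa).
  have -> : translate `|z|%N (translate z a) = a.
    by apply/funext => j; rewrite /translate; congr a; lia.
  move=> ->; apply/funext => j; rewrite /translate; congr (phi _); lia.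
Qed.

Lemma sliding_block_comp phi psi :
  sliding_block phi -> sliding_block psi -> sliding_block (phi \o psi).
Proof.
move=> [phiX [W locphi] phiT] [psiX [V locpsi] psiT]; split.
- by move=> a Xa; exact/phiX/psiX.
- exists (W + V)%N => a b Xa Xb ab; apply: locphi; [exact: psiX..|] => j Wj.
  have := locpsi (translate j a) (translate j b)
    (subshift_translate j Xa) (subshift_translate j Xb).
  rewrite !psiT // /translate add0r; apply=> i Vi; apply: ab; lia.
- by move=> z a Xa /=; rewrite psiT // phiT //; exact: psiX.
Qed.

Lemma sliding_block_iter phi s :
  sliding_block phi -> sliding_block (iter s phi).
Proof.
move=> sphi; elim: s => [|s IH]; last exact: sliding_block_comp.
by split=> //; exists 0%N => a b _ _; apply.
Qed.

(** A word that does not occur in X has to be given some value; its first letter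
is as good as any. *)
Lemma sliding_block_has_type phi : sliding_block phi ->
  exists m n (f : (m + n).+1.-tuple A -> A), has_type X phi f.
Proof.
move=> [phiX [W loc] phiT].
have /choice[f fP] : forall w : (W + W).+1.-tuple A, exists c : A,
    forall a, X a -> word (W + W).+1 a (- W%:Z) = w -> phi a 0 = c.
  move=> w; have [[a [Xa aw]]|na] := pselect
    (exists a, X a /\ word (W + W).+1 a (- W%:Z) = w).
    exists (phi a 0) => b Xb bw; apply: loc => // j Wj.
    have lt_j : (absz (j + W%:Z)%R < (W + W).+1)%N by lia.
    have := congr1 (fun w => tnth w (Ordinal lt_j)) (etrans bw (esym aw)).
    by rewrite !tnth_mktuple /= (_ : - W%:Z + _ = j); [move=> -> | lia].
  exists (thead w) => a Xa aw; exfalso; apply: na; by exists a.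
have phif a j : X a -> phi a j = f (word (W + W).+1 a (j - W%:Z)).
  move=> Xa; rewrite -(fP _ (translate j a)) //.
  - by rewrite phiT // /translate add0r.
  - exact: subshift_translate.
  - apply: eq_from_tnth => i; rewrite !tnth_mktuple /translate; congr a; lia.
exists W, W, f; split; last first.
  by move=> a Xa; apply/funext => j; exact: phif.
split.
- move=> w [a [Xa [j ->]]]; exists (phi a); split; first exact: phiX.
  exists (j + W%:Z); apply: eq_from_tnth => i; rewrite tnth_mktuple.
  rewrite (ord1 i) (tnth_nth (f (word (W + W).+1 a j))) /= phif //.
  by congr (f (word _ _ _)); lia.
- move=> a Xa; have := subshift_translate W%:Z (phiX _ Xa).
  congr X; apply/funext => j; rewrite /translate phif //.
  by congr (f (word _ _ _)); lia.
Qed.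

Lemma has_type_local phi m n (f : (m + n).+1.-tuple A -> A) a b j :
  has_type X phi f -> X a -> X b ->
  (forall i : int, j - m%:Z <= i <= j + n%:Z -> a i = b i) -> phi a j = phi b j.
Proof.
move=> [_ phif] Xa Xb ab; rewrite !phif //; congr f.
apply: eq_from_tnth => i; rewrite !tnth_mktuple; apply: ab.
have := ltn_ord i; lia.
Qed.

End SlidingBlocks.

(** * Transport of one-sided information *)

Section Sides.
Variables (A : finType) (X : set (full_shift A)).
Hypothesis hX : subshift X.
Variable d : int.

(** The condition gets stronger as i grows, and the supremum of the admitted i is
the degree P_L for d = 1 and P_R for d = -1. *)
Definition reach (phi : full_shift A -> full_shift A) (i : int) : Prop :=
  forall a b, X a -> X b -> agree_from d 0 a b ->
    agree_from d (- i) (phi a) (phi b).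

(** The positions d * j with j >= 0 are those where a and b are known to agree,
and the new letter is at - d. On the side d = -1 this is the condition whose
supremum is Q_R: a and b agree up to 0, their images up to 1 - i, and a_1 = b_1
is deduced. On the side d = 1 the supremum is Q_L. *)
Definition merges (phi : full_shift A -> full_shift A) (i : int) : Prop :=
  forall a b, X a -> X b -> agree_from d 0 a b ->
    agree_from d (i - 1) (phi a) (phi b) -> agree_from d (- 1) a b.

(** Right-closing is the case d = -1 (the points agree far to the left), and
left-closing the case d = 1. *)
Definition closing (phi : full_shift A -> full_shift A) : Prop :=
  forall a b, X a -> X b -> (exists t, agree_from d t a b) ->
    phi a = phi b -> a = b.

Lemma reach_le phi i j : j <= i -> reach phi i -> reach phi j.
Proof.
by move=> ji r a b Xa Xb ab; apply: agree_from_le (r a b Xa Xb ab); lia.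
Qed.

Lemma reach_from phi i t a b : sliding_block X phi -> reach phi i ->
  X a -> X b -> agree_from d t a b -> agree_from d (t - i) (phi a) (phi b).
Proof.
move=> [_ _ phiT] r Xa Xb ab; rewrite addrC.
apply/agree_from_translate; rewrite -!phiT //.
apply: r; [exact: subshift_translate..|].
by apply/agree_from_translate; rewrite add0r.
Qed.

Lemma merges_from phi i t a b : sliding_block X phi -> merges phi i ->
  X a -> X b -> agree_from d t a b ->
  agree_from d (t + i - 1) (phi a) (phi b) -> agree_from d (t - 1) a b.
Proof.
move=> [_ _ phiT] m Xa Xb ab pab; rewrite addrC.
apply/agree_from_translate; apply: m; [exact: subshift_translate..| |].
  by apply/agree_from_translate; rewrite add0r.
rewrite !phiT //; apply/agree_from_translate.
by rewrite addrC addrA.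
Qed.

(** The half-line of agreement [0, +oo) becomes [-j, +oo) under psi and then, by
translation invariance, [-j - i, +oo) under phi. *)
Lemma reach_comp phi psi i j : sliding_block X phi -> sliding_block X psi ->
  reach phi i -> reach psi j -> reach (phi \o psi) (i + j).
Proof.
move=> sphi spsi rphi rpsi a b Xa Xb ab.
have [psiX _ _] := spsi.
rewrite opprD addrC; apply: (@reach_from phi) => //; [exact: psiX..|].
exact: rpsi.
Qed.

(** If i exceeds the loss r of agreement under phi, the hypothesis on the images
in [merges] is automatic. *)
Lemma merges_lt_reach phi i r : merges phi i -> reach phi (- r) -> r < i ->
  forall a b, X a -> X b -> agree_from d 0 a b -> agree_from d (- 1) a b.
Proof.
move=> m rphi ri a b Xa Xb ab; apply: m => //.
by apply: agree_from_le (rphi a b Xa Xb ab); lia.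
Qed.

Hypothesis d_sign : d = 1 \/ d = - 1.

Lemma sliding_block_reach phi : sliding_block X phi -> exists i, reach phi i.
Proof.
move=> sphi; have [W locW] : exists W : nat, forall a b, X a -> X b ->
    agree_near W a b -> phi a 0 = phi b 0 by case: sphi.
have [_ _ phiT] := sphi; exists (- W%:Z) => a b Xa Xb ab j Wj.
have := locW _ _ (subshift_translate hX (d * j) Xa)
  (subshift_translate hX (d * j) Xb).
rewrite !phiT // /translate add0r; apply=> i Wi.
case: d_sign ab => -> ab.
- by have := ab (i + j); rewrite !mul1r; apply; lia.
- by have := ab (- i + j); rewrite !mulN1r opprD opprK; apply; lia.
Qed.

(** From the agreement of the images under phi psi one first recovers the
agreement of psi a and psi b, one letter at a time: psi a and psi b agree on
some half-line because a and b do, and each application of [merges] for phi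
extends it by one letter, as far as the composite images allow. This suffices
to apply [merges] for psi. *)
Lemma merges_comp phi psi i j : sliding_block X phi -> sliding_block X psi ->
  merges phi i -> merges psi j -> merges (phi \o psi) (i + j).
Proof.
move=> sphi spsi mphi mpsi a b Xa Xb ab pab.
have [psiX _ _] := spsi.
have [r rpsi] := sliding_block_reach spsi.
suff psiab (n : nat) : j - 1 <= - r - n%:Z ->
    agree_from d (- r - n%:Z) (psi a) (psi b).
  (* n is chosen so that - r - n = j - 1, the half-line that psi asks for *)
  apply: mpsi => //; case: (lerP (- r) (j - 1)) => rj.
    by apply: agree_from_le rj _; exact: rpsi.
  have := psiab (absz (- r - (j - 1))%R).
  rewrite (_ : - r - _ = j - 1); last by lia.
  by apply.
elim: n => [|n IH] nj; first by rewrite subr0; exact: rpsi.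
rewrite (_ : - r - n.+1%:Z = - r - n%:Z - 1); last by lia.
apply: merges_from mphi _ _ _ _ => //; [exact: psiX..| |].
  by apply: IH; lia.
by apply: agree_from_le pab; lia.
Qed.

(** If no i were admitted, there would be pairs agreeing on the half-line whose
images agree further and further beyond it, but with different next letters.
A cluster point of these pairs contradicts the closing property. *)
Lemma closing_merges phi : sliding_block X phi -> closing phi ->
  exists i, merges phi i.
Proof.
move=> sphi cl; apply: contrapT => /forallNP nm.
have /choice[uv uvP] (k : nat) : exists ab : full_shift A * full_shift A,
    [/\ X ab.1, X ab.2, agree_from d 0 ab.1 ab.2 /\
       agree_from d (- k%:Z) (phi ab.1) (phi ab.2)
     & ~ agree_from d (- 1) ab.1 ab.2].
  have /existsNP[a /existsNP[b]] := nm (1 - k%:Z).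
  move=> /not_implyP[Xa /not_implyP[Xb /not_implyP[ab /not_implyP[pab nab]]]].
  exists (a, b); split=> //; split=> //.
  by rewrite (_ : - k%:Z = 1 - k%:Z - 1) //; lia.
have [clX _] := hX.
have [a [b [Xa Xb clu]]] := @pair_cluster _ X (fun k => (uv k).1)
  (fun k => (uv k).2) clX (fun k => let: And4 p _ _ _ := uvP k in p)
  (fun k => let: And4 _ p _ _ := uvP k in p).
have ab0 : agree_from d 0 a b.
  move=> j j0; have [k [_ ak bk]] := clu `|j|%N 0%N.
  have [_ _ [uvk _] _] := uvP k.
  by rewrite ak ?bk ?uvk //; case: d_sign => ->; lia.
have [_ [W locW] phiT] := sphi.
have pab : phi a = phi b.
  apply/funext => p.
  have near c e : X c -> X e -> agree_near (W + `|p|)%N c e ->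
      phi c p = phi e p.
    move=> Xc Xe ce.
    have := locW _ _ (subshift_translate hX p Xc) (subshift_translate hX p Xe).
    by rewrite !phiT // /translate add0r; apply=> i Wi; apply: ce; lia.
  have [k [pk ak bk]] := clu (W + `|p|)%N `|p|%N.
  have [Xu Xv [_ puv] _] := uvP k.
  rewrite (near _ _ Xa Xu ak) (near _ _ Xb Xv bk).
  have := puv (d * p); rewrite mulrA (_ : d * d = 1).
    by rewrite mul1r; apply; case: d_sign => ->; lia.
  by case: d_sign => ->.
have [k [_ ak bk]] := clu 1%N 0%N; have [_ _ [uvk _]] := uvP k; apply.
have {}eab : a = b by apply: cl => //; exists 0.
move=> j j1; case: (lerP 0 j) => j0; first exact: uvk.
(* only the letter at - d is left, inside the window [-1, 1] *)
have dj : - 1 <= d * j <= 1 by case: d_sign => ->; lia.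
by rewrite -ak // -bk // eab.
Qed.

(** Suppose a half-line determines the next letter. By compactness M + 1
consecutive letters already do, so such a word determines everything on one
side of it. Hence X has at most as many points as there are words of
length M + 1: among more points two carry the same word far enough out, and
these agree on a window chosen to separate all the points. *)
Lemma infinite_not_determined : infinite_set X ->
  ~ forall a b, X a -> X b -> agree_from d 0 a b -> agree_from d (- 1) a b.
Proof.
move=> infX det.
have [M detM] : exists M : nat, forall a b, X a -> X b ->
    (forall j : int, 0 <= j <= M%:Z -> a (d * j) = b (d * j)) ->
    a (- d) = b (- d).
  apply: contrapT => /forallNP nM.
  have /choice[uv uvP] (k : nat) : exists ab : full_shift A * full_shift A,
    [/\ X ab.1, X ab.2,
       forall j : int, 0 <= j <= k%:Z -> ab.1 (d * j) = ab.2 (d * j)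
     & ab.1 (- d) <> ab.2 (- d)].
    have /existsNP[a /existsNP[b]] := nM k.
    by move=> /not_implyP[Xa /not_implyP[Xb /not_implyP[ab nab]]]; exists (a, b).
  have [clX _] := hX.
  have [a [b [Xa Xb clu]]] := @pair_cluster _ X (fun k => (uv k).1)
    (fun k => (uv k).2) clX (fun k => let: And4 p _ _ _ := uvP k in p)
    (fun k => let: And4 _ p _ _ := uvP k in p).
  have ab0 : agree_from d 0 a b.
    move=> j j0; have [k [jk ak bk]] := clu `|j|%N `|j|%N.
    have [_ _ uvk _] := uvP k.
    rewrite ak ?bk ?uvk //; first lia; case: d_sign => ->; lia.
  have [k [_ ak bk]] := clu 1%N 0%N; have [_ _ _] := uvP k; apply.
  have d1 : - 1 <= - d <= 1 by case: d_sign => ->.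
  rewrite -ak // -bk //.
  by have := det a b Xa Xb ab0 (- 1) (lexx _); rewrite mulrN1.
(* applied repeatedly, this determines all the letters on one side of a word *)
have side (t : int) a b : X a -> X b ->
    (forall j : int, t <= j <= t + M%:Z -> a (d * j) = b (d * j)) ->
    forall j : int, j <= t + M%:Z -> a (d * j) = b (d * j).
  move=> Xa Xb ab.
  suff win (n : nat) (j : int) : t - n%:Z <= j <= t + M%:Z ->
      a (d * j) = b (d * j).
    by move=> j jt; apply: (win `|t - j|%N); lia.
  elim: n j => [|n IH] j jn; first by apply: ab; lia.
  case: (lerP (t - n%:Z) j) => tj; first by apply: IH; lia.
  have := detM (translate (d * (j + 1)) a) (translate (d * (j + 1)) b)
    (subshift_translate hX _ Xa) (subshift_translate hX _ Xb).
  rewrite /translate (_ : - d + d * (j + 1) = d * j); last by lia.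
  by apply=> i iM; rewrite -mulrDr; apply: IH; lia.
(* pigeonhole: one more point of X than there are words of length M + 1 *)
pose T := (M.+1.-tuple A : finType).
have [B BX szB] := infinite_set_fset #|T|.+1 infX.
have [a0 Xa0] := infinite_setN0 infX.
pose g (i : 'I_#|T|.+1) := nth a0 (finmap.enum_fset B) i.
have gX i : X (g i).
  apply: BX; rewrite /=; apply: mem_nth; exact: leq_trans szB.
have g_inj : injective g.
  move=> i i' /eqP; rewrite nth_uniq.
  - by move=> /eqP/val_inj.
  - exact: leq_trans szB.
  - exact: leq_trans szB.
  - exact: finmap.fset_uniq.
have /choice[k kP] (p : 'I_#|T|.+1 * 'I_#|T|.+1) : exists k : nat,
    agree_near k (g p.1) (g p.2) -> p.1 = p.2.
  have [e|ne] := eqVneq p.1 p.2; first by exists 0%N.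
  have [j nj] : exists j, g p.1 j <> g p.2 j.
    apply/existsNP => e; move/eqP: ne; apply; apply: g_inj; exact/funext.
  by exists `|j|%N => agr; case: nj; apply: agr; lia.
(* the window [-K, K] separates all the points g i; the words start at K, so
   that the side they determine covers this window *)
pose K := (\max_p k p)%N.
pose w (i : 'I_#|T|.+1) : T := [tuple g i (d * (K + s)%N%:Z) | s < M.+1].
suff w_inj : injective w by have := leq_card w w_inj; rewrite card_ord ltnn.
move=> i i' ww; apply: (kP (i, i')) => j jk /=.
have kK : (k (i, i') <= K)%N by exact: leq_bigmax.
have := @side K%:Z (g i) (g i') (gX i) (gX i') _ (d * j).
rewrite mulrA (_ : d * d = 1); last by case: d_sign => ->.
rewrite mul1r; apply; last by case: d_sign => ->; lia.
move=> s sM; have lt_s : (absz (s - K%:Z)%R < M.+1)%N by lia.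
have := congr1 (fun w => tnth w (Ordinal lt_s)) ww.
by rewrite !tnth_mktuple /= (_ : (K + `|s - K%:Z|)%N%:Z = s) //; lia.
Qed.

End Sides.

(** * Suprema of integers and rates of growth *)

Section Heights.
Variable R : realType.

(** The supremum is -oo when no integer is admitted, which matches the value
of r - k when k = +oo for mergibility. *)
Definition height (D : int -> Prop) : \bar R :=
  ereal_sup [set i%:~R%:E | i in [set i | D i]].

Lemma height_shift (D E : int -> Prop) (c : int) :
  (forall i, D i -> E (i + c)) -> (height D + c%:~R%:E <= height E)%E.
Proof.
move=> DE; rewrite -leeBrDr //; apply: ge_ereal_sup => _ [i Di <-].
rewrite leeBrDr // -EFinD -intrD; apply: ereal_sup_ubound.
by exists (i + c) => //; exact: DE.
Qed.

Lemma height_max (D : int -> Prop) (i : int) :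
  D i -> (forall j, D j -> j <= i) -> height D = i%:~R%:E.
Proof.
move=> Di maxi; apply/eqP; rewrite eq_le; apply/andP; split.
  by apply: ge_ereal_sup => _ [j Dj <-]; rewrite lee_fin ler_int; exact: maxi.
by apply: ereal_sup_ubound; exists i.
Qed.

Lemma height_pinfty (D : int -> Prop) : (forall i, D i) -> height D = +oo%E.
Proof.
move=> DT; apply/eqyP => x x0; apply: (@le_trans _ _ (Num.ceil x)%:~R%:E).
  by rewrite lee_fin Num.Theory.ceil_ge.
by apply: ereal_sup_ubound; exists (Num.ceil x).
Qed.

Lemma height_ninfty (D : int -> Prop) : (forall i, ~ D i) -> height D = -oo%E.
Proof.
move=> D0; apply/eqP; rewrite -leeNy_eq; apply: ge_ereal_sup => _ [i Di <-].
by have := D0 i Di.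
Qed.

End Heights.

Section Growth.
Variable R : realType.
Implicit Types u v : (\bar R)^nat.

Definition rate u : (\bar R)^nat := (fun s => u s * s%:R^-1%:E)%E.

(** Factors tending to 1 and finite terms tending to 0 do not affect a limit, even
an infinite one: the product of l with 1 is never indeterminate. *)
Lemma cvg_perturb (x : (\bar R)^nat) (l : \bar R) (al be : R) :
  x @ \oo --> l ->
  ((x s * (1 + al * harmonic s.+1)%:E + (be * harmonic s.+1)%:E)%E
    @[s --> \oo] --> l).
Proof.
move=> xl.
have h0 : (harmonic s.+1 : R) @[s --> \oo] --> (0 : R).
  by rewrite (cvg_shiftS (@harmonic R)); exact: cvg_harmonic.
have h1 : (1 + al * harmonic s.+1 : R) @[s --> \oo] --> (1 : R).
  rewrite -[X in _ --> X]addr0 -[X in _ --> _ + X](mulr0 al).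
  by apply: cvgD; [exact: cvg_cst | apply: cvgMr].
have h2 : (be * harmonic s.+1 : R) @[s --> \oo] --> (0 : R).
  by rewrite -[X in _ --> X](mulr0 be); apply: cvgMr.
rewrite -[X in _ --> X]adde0 -[X in _ --> (X + _)%E]mule1.
apply: cvgeD; first by rewrite fin_num_adde_defl.
- apply: cvgeM => //; first by rewrite mule_defE onee_eq0 /= normr1 andbF.
  by apply: cvg_EFin => //; exact: nearW.
- by apply: cvg_EFin => //; exact: nearW.
Qed.

(** Comparing terms of neighbouring indices changes the denominator from p to q;
the correction p / q tends to 1. *)
Lemma rate_rescale (y : \bar R) (c p q : R) : 0 < p -> 0 < q ->
  ((y + c%:E) * q^-1%:E = y * p^-1%:E * (p / q)%:E + (c / q)%:E)%E.
Proof.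
move=> p0 q0; rewrite muleDl // ?fin_num_adde_defl // -muleA -!EFinM.
by rewrite mulrA mulVf ?mul1r // gt_eqF.
Qed.

(** The hypotheses give v (s + 2) between u (s + 1) + c and u (s + 3) - c, and the
bounds divided by s + 2 are perturbations of rates of u. Starting at s + 2 keeps
all denominators positive. *)
Lemma cvg_rate_interleaved u v (c : R) (l : \bar R) :
  (forall s, u s + c%:E <= v s.+1)%E -> (forall s, v s + c%:E <= u s.+1)%E ->
  rate u @ \oo --> l -> rate v @ \oo --> l.
Proof.
move=> uv vu ul; rewrite -(cvg_shiftn 2).
(* with h = 1 / (s + 2), the quotients (s + 1) / (s + 2) and (s + 3) / (s + 2)
   are 1 - h and 1 + h *)
apply: (@squeeze_cvge _ _ _ _
  (fun s => rate u s.+1 * (1 + - 1 * harmonic s.+1)%:E +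
    (c * harmonic s.+1)%:E)%E _
  (fun s => rate u (s + 3)%N * (1 + 1 * harmonic s.+1)%:E +
    (- c * harmonic s.+1)%:E)%E).
- apply: nearW => s; rewrite /harmonic /rate /= addn2 addn3.
  have n0 : s.+2%:R != 0 :> R by rewrite pnatr_eq0.
  apply/andP; split.
  + rewrite (_ : 1 + _ = s.+1%:R / s.+2%:R); last first.
      rewrite -[s.+1%:R](addrK 1) natr1 mulrBl divff //.
      by rewrite mulN1r mul1r.
    rewrite -rate_rescale ?ltr0n //.
    by apply: lee_wpmul2r; [rewrite lee_fin invr_ge0 | exact: uv].
  + rewrite (_ : 1 + _ = s.+3%:R / s.+2%:R); last first.
      by rewrite -(natr1 s.+2) mulrDl divff.
    rewrite -rate_rescale ?ltr0n //.
    apply: lee_wpmul2r; first by rewrite lee_fin invr_ge0.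
    by rewrite EFinN leeBrDr.
- by apply: cvg_perturb; rewrite (cvg_shiftS (rate u)).
- by apply: cvg_perturb; rewrite (cvg_shiftn 3 (rate u)).
Qed.

(** The limit is chosen among all the limits of the sequence, so it suffices that
both sequences have the same limits; this covers divergent sequences. *)
Lemma lim_rate_interleaved u v (c : R) :
  (forall s, u s + c%:E <= v s.+1)%E -> (forall s, v s + c%:E <= u s.+1)%E ->
  limn (rate u) = limn (rate v).
Proof.
move=> uv vu; congr (get _); apply/funext => l; apply/propext.
by split; exact: cvg_rate_interleaved.
Qed.

End Growth.

(** * The degrees as suprema *)

Section StrictDegreesAsHeights.
Variable R : realType.

Lemma strictly_redundant_ex (red : nat -> Prop) :
  red 0%N -> exists I : \bar R, strictly_redundant red I.
Proof.
move=> red0; have [redT|] := pselect (forall i, red i).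
  by exists +oo%E; right.
move=> nred; have [i [ri nri]] : exists i, red i /\ ~ red i.+1.
  apply: contrapT => /forallNP step; apply: nred; elim=> // i ri.
  by apply: contrapT => nri; apply: (step i).
by exists i%:R%:E; left; exists i.
Qed.

Lemma strictly_redundant_height (red : nat -> Prop) (D : int -> Prop) (r : nat)
    (I : \bar R) :
  (forall i j, j <= i -> D i -> D j) ->
  (forall i : nat, red i <-> D (i%:Z - r%:Z)) ->
  strictly_redundant red I -> (I - r%:R%:E)%E = height R D.
Proof.
move=> D_le redD [[i [-> /redD Di ni]]|[-> redT]].
- rewrite (@height_max _ _ (i%:Z - r%:Z)) //; first by rewrite intrB EFinB.
  move=> j Dj; case: (lerP j (i%:Z - r%:Z)) => // ij; exfalso; apply: ni.
  by apply/redD; apply: D_le Dj; lia.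
- rewrite addye // height_pinfty // => i.
  by apply: D_le ((redD (absz (i + r%:Z)%R)).1 (redT _)); lia.
Qed.

Lemma strictly_mergible_ex (mer : nat -> Prop) :
  exists k : \bar R, strictly_mergible mer k.
Proof.
have [[k mk]|/forallNP nmer] := pselect (exists k, mer k); last first.
  by exists +oo%E; right.
have exk : exists k, `[< mer k >] by exists k; apply/asboolP.
case: (ex_minnP exk) => i /asboolP mi mini.
by exists i%:R%:E; left; exists i; split=> // j /asboolP; exact: mini.
Qed.

(** The bound by r is needed because the degrees k are natural numbers: only the
integers r - k <= r are seen by mergibility. *)
Lemma strictly_mergible_height (mer : nat -> Prop) (D : int -> Prop) (r : nat)
    (k : \bar R) :
  (forall i, D i -> i <= r%:Z) ->
  (forall i : nat, mer i <-> D (r%:Z - i%:Z)) ->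
  strictly_mergible mer k -> (r%:R%:E - k)%E = height R D.
Proof.
move=> D_le merD [[i [-> /merD Di mini]]|[-> nmer]].
- rewrite (@height_max _ _ (r%:Z - i%:Z)) //; first by rewrite intrB EFinB.
  move=> j Dj; have jr := D_le _ Dj.
  have /merD/mini : D (r%:Z - (absz (r%:Z - j)%R)%:Z).
    by rewrite (_ : _ - _ = j) //; lia.
  lia.
- rewrite height_ninfty // => i Di; have ir := D_le _ Di.
  apply: (nmer (absz (r%:Z - i)%R)); apply/merD.
  by rewrite (_ : _ - _ = i) //; lia.
Qed.

End StrictDegreesAsHeights.

Lemma get_unique (T : pointedType) (S : set T) (x : T) :
  (exists y, S y) -> (forall y, S y -> y = x) -> get S = x.
Proof. by move=> /getPex S_get; apply. Qed.

Section DegreesOfTypes.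
Variables (A : finType) (X : set (full_shift A)).
Hypothesis hX : subshift X.
Variables (phi : full_shift A -> full_shift A) (m n : nat).
Variable f : (m + n).+1.-tuple A -> A.
Hypothesis sphi : sliding_block X phi.
Hypothesis typ : has_type X phi f.

Lemma has_type_word a p : X a -> f (word (m + n).+1 a p) = phi a (p + m%:Z).
Proof. by move=> Xa; case: typ => _ /(_ a Xa) ->; rewrite addrK. Qed.

(** Only the last position of the half-line matters, as the others follow by
translation. Redundancy is phrased with that position. *)
Lemma reach_at d i : reach X d phi i <->
  (forall a b, X a -> X b -> agree_from d 0 a b ->
    phi a (d * - i) = phi b (d * - i)).
Proof.
split=> [r a b Xa Xb ab|r a b Xa Xb ab j ij].
  exact: (r a b Xa Xb ab _ (lexx _)).
have [_ _ phiT] := sphi.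
have := r (translate (d * (j + i)) a) (translate (d * (j + i)) b).
rewrite !phiT // /translate -mulrDr (_ : - i + (j + i) = j); last by lia.
apply; [exact: (subshift_translate hX)..|].
by apply/agree_from_translate; apply: agree_from_le ab; lia.
Qed.

Lemma has_type_reach_left : reach X 1 phi (- m%:Z).
Proof.
move=> a b Xa Xb /agree_from1 ab; apply/agree_from1 => j mj.
by apply: (has_type_local typ) => // i ij; apply: ab; lia.
Qed.

Lemma has_type_reach_right : reach X (- 1) phi (- n%:Z).
Proof.
move=> a b Xa Xb /agree_fromN1 ab; apply/agree_fromN1 => j mj.
by apply: (has_type_local typ) => // i ij; apply: ab; lia.
Qed.

Lemma left_redundant_reach (I : nat) :
  left_redundant X f I <-> reach X 1 phi (I%:Z - m%:Z).
Proof.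
have pos : - I%:Z + m%:Z = 1 * - (I%:Z - m%:Z) by lia.
split=> [red|/reach_at r a b Xa Xb ab].
  apply/reach_at => a b Xa Xb /agree_from1 ab.
  by have := red a b Xa Xb ab; rewrite !has_type_word // pos.
rewrite !has_type_word // pos; apply: r => //.
exact/agree_from1.
Qed.

Lemma right_redundant_reach (J : nat) :
  right_redundant X f J <-> reach X (- 1) phi (J%:Z - n%:Z).
Proof.
have pos : J%:Z - (m + n)%N%:Z + m%:Z = - 1 * - (J%:Z - n%:Z) by lia.
split=> [red|/reach_at r a b Xa Xb ab].
  apply/reach_at => a b Xa Xb /agree_fromN1 ab.
  by have := red a b Xa Xb ab; rewrite !has_type_word // pos.
rewrite !has_type_word // pos; apply: r => //.
exact/agree_fromN1.
Qed.

(** Mergibility speaks only of finitely many positions of the images; at the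
others the images agree because a and b do ([has_type_reach_left]). *)
Lemma left_mergible_merges (l : nat) :
  left_mergible X f l <-> merges X 1 phi (m%:Z - l%:Z).
Proof.
split=> [mer a b Xa Xb /agree_from1 ab /agree_from1 pab|].
  apply/agree_from1 => j j1; case: (lerP 0 j) => j0; first exact: ab.
  rewrite (_ : j = - 1); last by lia.
  apply: mer => // i il; rewrite !has_type_word //; apply: pab; lia.
move=> mer a b Xa Xb ab pab.
suff /agree_from1 : agree_from 1 (- 1) a b by apply.
apply: mer => //; first exact/agree_from1.
apply/agree_from1 => j jl; case: (lerP m%:Z j) => mj.
  have /agree_from1 := has_type_reach_left Xa Xb ((agree_from1 a b 0).2 ab).
  by apply; lia.
have := pab (m%:Z - j).
by rewrite !has_type_word // opprB subrK; apply; lia.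
Qed.

Lemma right_mergible_merges (k : nat) :
  right_mergible X f k <-> merges X (- 1) phi (n%:Z - k%:Z).
Proof.
have pos j : j - (m + n)%N%:Z + m%:Z = j - n%:Z by lia.
split=> [mer a b Xa Xb /agree_fromN1 ab /agree_fromN1 pab|].
  apply/agree_fromN1 => j j1; case: (lerP j 0) => j0; first by apply: ab.
  rewrite (_ : j = 1); last by lia.
  apply: mer => // i il; rewrite !has_type_word // pos; apply: pab; lia.
move=> mer a b Xa Xb ab pab.
suff /agree_fromN1 : agree_from (- 1) (- 1) a b by apply.
apply: mer => //; first exact/agree_fromN1.
apply/agree_fromN1 => j jl; case: (lerP j (- n%:Z)) => nj.
  have /agree_fromN1 := has_type_reach_right Xa Xb ((agree_fromN1 a b 0).2 ab).
  by apply; lia.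
have := pab (j + n%:Z).
by rewrite !has_type_word // pos addrK; apply; lia.
Qed.

End DegreesOfTypes.

Section DegreesAsHeights.
Variables (R : realType) (A : finType) (X : set (full_shift A)).
Hypothesis hX : subshift X.
Variable phi : full_shift A -> full_shift A.
Hypothesis sphi : sliding_block X phi.

Lemma P_L_height : P_L R X phi = height R (reach X 1 phi).
Proof.
apply: get_unique.
  have [m [n [f typ]]] := sliding_block_has_type hX sphi.
  have [|I strI] := @strictly_redundant_ex R (left_redundant X f).
    by apply/(left_redundant_reach hX sphi typ); rewrite sub0r;
       exact: has_type_reach_left typ.
  by exists (I - m%:R%:E)%E, m, n, f, I.
move=> _ [m [n [f [I [typ strI ->]]]]].
apply: (strictly_redundant_height _ (left_redundant_reach hX sphi typ) strI).
by move=> i j; exact: reach_le.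
Qed.

Lemma P_R_height : P_R R X phi = height R (reach X (- 1) phi).
Proof.
apply: get_unique.
  have [m [n [f typ]]] := sliding_block_has_type hX sphi.
  have [|I strI] := @strictly_redundant_ex R (right_redundant X f).
    by apply/(right_redundant_reach hX sphi typ); rewrite sub0r;
       exact: has_type_reach_right typ.
  by exists (I - n%:R%:E)%E, m, n, f, I.
move=> _ [m [n [f [I [typ strI ->]]]]].
apply: (strictly_redundant_height _ (right_redundant_reach hX sphi typ) strI).
by move=> i j; exact: reach_le.
Qed.

Hypothesis infX : infinite_set X.

(** Otherwise every half-line would determine the next letter. *)
Lemma merges_le_reach d i r : d = 1 \/ d = - 1 ->
  reach X d phi (- r) -> merges X d phi i -> i <= r.
Proof.
move=> hd rphi mphi; case: (lerP i r) => // ri.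
by have := infinite_not_determined hX hd infX (merges_lt_reach mphi rphi ri).
Qed.

Lemma Q_R_height : Q_R R X phi = height R (merges X (- 1) phi).
Proof.
rewrite /Q_R asboolF //; apply: get_unique.
  have [m [n [f typ]]] := sliding_block_has_type hX sphi.
  have [k strk] := @strictly_mergible_ex R (right_mergible X f).
  by exists (n%:R%:E - k)%E, m, n, f, k.
move=> _ [m [n [f [k [typ strk ->]]]]].
apply: (strictly_mergible_height _ (right_mergible_merges typ) strk).
move=> i; apply: merges_le_reach; first by right.
exact: has_type_reach_right typ.
Qed.

Lemma Q_L_height : Q_L R X phi = height R (merges X 1 phi).
Proof.
rewrite /Q_L asboolF //; apply: get_unique.
  have [m [n [f typ]]] := sliding_block_has_type hX sphi.
  have [k strk] := @strictly_mergible_ex R (left_mergible X f).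
  by exists (m%:R%:E - k)%E, m, n, f, k.
move=> _ [m [n [f [k [typ strk ->]]]]].
apply: (strictly_mergible_height _ (left_mergible_merges typ) strk).
move=> i; apply: merges_le_reach; first by left.
exact: has_type_reach_left typ.
Qed.

End DegreesAsHeights.

(** * The limits and the effect of exchanging the factors *)

Section LimitsAsRates.
Variables (R : realType) (A : finType) (X : set (full_shift A)).
Hypothesis hX : subshift X.
Variable phi : full_shift A -> full_shift A.
Hypothesis sphi : sliding_block X phi.

Lemma p_L_rate :
  p_L R X phi = limn (rate (fun s => height R (reach X 1 (iter s phi)))).
Proof.
congr (limn _); apply/funext => s.
by rewrite P_L_height //; exact: sliding_block_iter.
Qed.

Lemma p_R_rate :
  p_R R X phi = limn (rate (fun s => height R (reach X (- 1) (iter s phi)))).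
Proof.
congr (limn _); apply/funext => s.
by rewrite P_R_height //; exact: sliding_block_iter.
Qed.

Hypothesis infX : infinite_set X.

Lemma q_R_rate :
  q_R R X phi = limn (rate (fun s => height R (merges X (- 1) (iter s phi)))).
Proof.
congr (limn _); apply/funext => s.
by rewrite Q_R_height //; exact: sliding_block_iter.
Qed.

Lemma q_L_rate :
  q_L R X phi = limn (rate (fun s => height R (merges X 1 (iter s phi)))).
Proof.
congr (limn _); apply/funext => s.
by rewrite Q_L_height //; exact: sliding_block_iter.
Qed.

End LimitsAsRates.

Lemma right_closing_closing (A : finType) (X : set (full_shift A)) phi :
  right_closing X phi -> closing X (- 1) phi.
Proof.
move=> cl a b Xa Xb [t /agree_fromN1 ab]; apply: cl => //.
by exists (- t).
Qed.

Lemma left_closing_closing (A : finType) (X : set (full_shift A)) phi :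
  left_closing X phi -> closing X 1 phi.
Proof.
move=> cl a b Xa Xb [t /agree_from1 ab]; apply: cl => //.
by exists t.
Qed.

Lemma iter_comp_swap (T : Type) (f g : T -> T) s :
  iter s.+1 (f \o g) = f \o (iter s (g \o f) \o g).
Proof.
by apply/funext => x; elim: s => //= s IH; rewrite IH.
Qed.

(** The common argument for the four degrees: [D f i] is any predicate that is
superadditive under composition. *)
Section Swap.
Variables (R : realType) (A : finType) (X : set (full_shift A)).
Hypothesis hX : subshift X.
Variable D : (full_shift A -> full_shift A) -> int -> Prop.
Hypothesis D_comp : forall f g i j,
  sliding_block X f -> sliding_block X g -> D f i -> D g j -> D (f \o g) (i + j).

Lemma lim_rate_height_swap phi psi :
  sliding_block X phi -> sliding_block X psi ->
  (exists i, D phi i) -> (exists j, D psi j) ->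
  limn (rate (fun s => height R (D (iter s (phi \o psi))))) =
  limn (rate (fun s => height R (D (iter s (psi \o phi))))).
Proof.
move=> sphi spsi [i Di] [j Dj].
have step f g k l s : sliding_block X f -> sliding_block X g ->
    D f k -> D g l ->
    (height R (D (iter s (g \o f))) + (k + l)%:~R%:E <=
     height R (D (iter s.+1 (f \o g))))%E.
  move=> sf sg Df Dg; apply: height_shift => t Dt.
  have sgf : sliding_block X (iter s (g \o f)).
    by apply: sliding_block_iter => //; exact: sliding_block_comp.
  rewrite iter_comp_swap addrCA; apply: D_comp => //.
    exact: sliding_block_comp.
  exact: D_comp.
apply: (@lim_rate_interleaved _ _ _ (i + j)%:~R) => s; last exact: step.
by rewrite (addrC i); exact: step.
Qed.

End Swap.

Theorem theorem9p5 (R : realType) (A : finType) (hA : (2 <= #|A|)%N)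
    (X : set (full_shift A)) (hX : subshift X)
    (phi psi : full_shift A -> full_shift A)
    (hphi : endomorphism X phi) (hpsi : endomorphism X psi) :
  [/\ (forall i : nat, infinite_set (iter i phi @` X) /\
                       infinite_set (iter i psi @` X)) ->
        (- p_L R X (phi \o psi) = - p_L R X (psi \o phi))%E /\
        p_R R X (phi \o psi) = p_R R X (psi \o phi),
      infinite_set X -> phi @` X = X -> psi @` X = X ->
        (- p_L R X (phi \o psi) = - p_L R X (psi \o phi))%E /\
        p_R R X (phi \o psi) = p_R R X (psi \o phi),
      right_closing X phi -> right_closing X psi ->
        (- q_R R X (phi \o psi) = - q_R R X (psi \o phi))%E
    & left_closing X phi -> left_closing X psi ->
        q_L R X (phi \o psi) = q_L R X (psi \o phi)].
Proof.
have sphi := endomorphism_sliding_block hX hphi.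
have spsi := endomorphism_sliding_block hX hpsi.
have scomp f g : sliding_block X f -> sliding_block X g ->
    sliding_block X (f \o g) by exact: sliding_block_comp.
have reach_swap d : d = 1 \/ d = - 1 ->
    limn (rate (fun s => height R (reach X d (iter s (phi \o psi))))) =
    limn (rate (fun s => height R (reach X d (iter s (psi \o phi))))).
  move=> hd; apply: (lim_rate_height_swap _ hX _ sphi spsi
    (sliding_block_reach hX hd sphi) (sliding_block_reach hX hd spsi)).
  by move=> f g i j; exact: reach_comp.
have merges_swap d : d = 1 \/ d = - 1 -> closing X d phi -> closing X d psi ->
    limn (rate (fun s => height R (merges X d (iter s (phi \o psi))))) =
    limn (rate (fun s => height R (merges X d (iter s (psi \o phi))))).
  move=> hd clphi clpsi; apply: (lim_rate_height_swap _ hX _ sphi spsi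
    (closing_merges hX hd sphi clphi) (closing_merges hX hd spsi clpsi)).
  by move=> f g i j; exact: merges_comp.
have pLR : (- p_L R X (phi \o psi) = - p_L R X (psi \o phi))%E /\
    p_R R X (phi \o psi) = p_R R X (psi \o phi).
  rewrite !p_L_rate ?p_R_rate //; try exact: scomp.
  by rewrite !reach_swap //; [right | left].
split=> // clphi clpsi.
- have [finX|infX] := pselect (finite_set X).
    by rewrite /q_R /Q_R asboolT.
  rewrite !q_R_rate //; try exact: scomp.
  by rewrite merges_swap //; [right | exact: right_closing_closing..].
- have [finX|infX] := pselect (finite_set X).
    by rewrite /q_L /Q_L asboolT.
  rewrite !q_L_rate //; try exact: scomp.
  by rewrite merges_swap //; [left | exact: left_closing_closing..].
Qed.
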